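(* Let $X=(X_n)_{n\in\mathbf{Z}}$ be an inhomogeneous constructive Markov chain governed by a sequence of random variables $V=(V_n)_{n\in\mathbf{Z}}$ and a sequence of measurable maps $(f_n)_{n\in\mathbf{Z}}$ (as defined in the context), whose state spaces $(E_n,\mathcal{E}_n)$ are Lusin (standard Borel) spaces. Then, almost surely, the conditional law of $X$ given $\sigma(V)\vee\mathcal{F}_{-\infty}$ is either diffuse or uniform on a finite set. Moreover, the number of atoms of this conditional law (and hence their mass) is an $\mathcal{F}_{-\infty}$-measurable random variable.
   Context: All random variables are defined on a common probability space $(\Omega,\mathcal{A},P)$. Inhomogeneous constructive chain: for every $n\in\mathbf{Z}$, $X_n$ is a random variable with values in a measurable space $(E_n,\mathcal{E}_n)$; $V_{n+1}$ is a random variable with values in a measurable space $(G_{n+1},\mathcal{G}_{n+1})$, independent of the sequence $((X_k,V_k))_{k\le n}$; and $X_{n+1}=f_n(X_n,V_{n+1})$, where $f_n$ is a measurable map from $(E_n\times G_{n+1},\mathcal{E}_n\otimes\mathcal{G}_{n+1})$ to $(E_{n+1},\mathcal{E}_{n+1})$. For a sequence of random variables $(Y_n)_{n\in\mathbf{Z}}$, $\mathcal{F}^Y_n$ denotes the $P$-completion of $\sigma(Y_k: k\le n)$, and $\mathcal{F}^Y_{-\infty}=\bigcap_{n\in\mathbf{Z}}\mathcal{F}^Y_n$; for $Y=((X_n,V_n))_{n\in\mathbf{Z}}$ one writes $\mathcal{F}^{(X,V)}_{-\infty}$. For constructive chains $\mathcal{F}_{-\infty}^{(X,V)}=\mathcal{F}_{-\infty}^{X}$,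 and $\mathcal{F}_{-\infty}$ denotes this common $\sigma$-algebra. All $\sigma$-algebras are completed. $X$ is regarded as a random variable with values in $\prod_{k\in\mathbf{Z}}E_k$ with the product $\sigma$-algebra (a standard Borel space), and the conditional law is a regular version. A probability measure is diffuse if it has no atoms (no point has positive mass). *)

(* Defs.v *)
From HB Require Import structures.
From mathcomp Require Import all_boot all_order all_algebra finmap.
From mathcomp Require Import all_classical all_reals all_analysis measurable_realfun.

Set Implicit Arguments.
Unset Strict Implicit.
Unset Printing Implicit Defensive.

Import Order.TTheory GRing.Theory Num.Theory.
Import numFieldNormedType.Exports.

Local Open Scope classical_set_scope.
Local Open Scope ring_scope.

Definition polish (R : realType) (Y : completePseudoMetricType R) : Prop :=
  hausdorff_space Y /\ @second_countable Y.

(* phi is an isomorphism onto a Borel subset of Y with its trace sigma-algebra. *)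
Definition standard_borel (R : realType) (d : measure_display)
    (T : measurableType d) : Prop :=
  exists (Y : completePseudoMetricType R) (phi : T -> Y),
    [/\ polish Y, injective phi, <<s [set U : set Y | open U] >> (range phi) &
      @measurable d T =
        preimage_set_system setT phi <<s [set U : set Y | open U] >>].

Definition sigma_of (W I : Type) (dT : I -> measure_display)
    (T : forall i, measurableType (dT i)) (Y : forall i, W -> T i)
    (D : set I) : set_system W :=
  <<s \bigcup_(i in D) preimage_set_system setT (Y i) measurable >>.

Definition join_sigma (W : Type) (F G : set_system W) : set_system W :=
  <<s F `|` G >>.

Definition coord (I : Type) (T : I -> Type) (i : I) (x : forall j, T j) : T i :=
  x i.

(* The product of the E i, with the sigma-algebra generated by the coordinates. *)
Notation product_space E := (g_sigma_algebraType (sigma_of (coord (T := E)) setT)).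

Section probability_space.
Variables (R : realType) (d : measure_display) (W : measurableType d).
Variable P : probability W R.

(* P.-negligible is the family of all subsets of null sets; the completion stays
   inside the ambient sigma-algebra when the latter is complete. *)
Definition completion (F : set_system W) : set_system W :=
  join_sigma F P.-negligible.

Definition independent (F G : set_system W) : Prop :=
  forall A B, F A -> G B -> P (A `&` B) = (P A * P B)%E.

Definition past (dT : int -> measure_display)
    (T : forall n, measurableType (dT n)) (Y : forall n, W -> T n) (n : int) :
    set_system W :=
  completion (sigma_of Y [set k | k <= n]).

Definition remote_past (dT : int -> measure_display)
    (T : forall n, measurableType (dT n)) (Y : forall n, W -> T n) :
    set_system W :=
  \bigcap_(n in [set: int]) past Y n.

(* For a sub-sigma-algebra F, mu is a regular version of the conditional law
   of Z given F; the F-measurability of mu is part of its kernel type. *)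
Definition is_conditional_law (F : set_system W) (dT : measure_display)
    (T : measurableType dT) (Z : W -> T)
    (mu : R.-pker (g_sigma_algebraType F) ~> T) : Prop :=
  forall (A : set W) (B : set T), F A -> measurable B ->
    (\int[P]_(w in A) mu w B)%E = P (A `&` Z @^-1` B).

Section chain.
Variables (dE dG : int -> measure_display).
Variables (E : forall n, measurableType (dE n)).
Variables (G : forall n, measurableType (dG n)).

Definition pair_process (X : forall n, W -> E n) (V : forall n, W -> G n)
    (n : int) (w : W) : (E n * G n)%type := (X n w, V n w).

(* The recursion is an equality of random variables, i.e. almost sure. *)
Record constructive_chain (X : forall n, W -> E n) (V : forall n, W -> G n)
    (f : forall n, (E n * G (n + 1)%R)%type -> E (n + 1)) : Prop := {
  chain_measurable_X : forall n, measurable_fun setT (X n);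
  chain_measurable_V : forall n, measurable_fun setT (V n);
  chain_measurable_f : forall n, measurable_fun setT (f n);
  chain_independent : forall n,
    independent (sigma_of V [set n + 1])
                (sigma_of (pair_process X V) [set k | k <= n]);
  chain_recursion : forall n,
    {ae P, forall w, X (n + 1) w = f n (X n w, V (n + 1) w)} }.

End chain.
End probability_space.

Section laws.
Variables (R : realType) (d : measure_display) (T : measurableType d).

Definition atoms (mu : set T -> \bar R) : set T :=
  [set x | (0 < mu [set x])%E].

Definition diffuse (mu : set T -> \bar R) : Prop := atoms mu = set0.

Definition uniform_on_finite_set (mu : set T -> \bar R) : Prop :=
  exists S : set T, [/\ finite_set S, S !=set0 &
    forall B, measurable B ->
      mu B = (#|` fset_set (S `&` B)|%:R / #|` fset_set S|%:R)%:E].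

(* Valued in \bar R: +oo when there are infinitely many atoms. *)
Definition number_of_atoms (mu : set T -> \bar R) : \bar R :=
  counting (atoms mu).

End laws.

(* Main.v *)
Require Import Defs.
From HB Require Import structures.
From mathcomp Require Import all_boot all_order all_algebra finmap.
From mathcomp Require Import all_classical all_reals all_analysis measurable_realfun.

Set Implicit Arguments.
Unset Strict Implicit.
Unset Printing Implicit Defensive.

Import Order.TTheory GRing.Theory Num.Theory.
Import numFieldNormedType.Exports.

Local Open Scope classical_set_scope.
Local Open Scope ring_scope.

(** Write F_n for the completed past of (X, V) up to time n, F_-oo for the
    intersection of the F_n, and mu w for the conditional law of X given
    sigma(V) \/ F_-oo at w. The idea is to look at the mass U(w) = mu w {X(w)}
    that the conditional law gives to the actual trajectory.

    U is F_-oo-measurable. Fix n. Almost surely, mu w is carried by trajectories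
    that follow the recursion driven by V(w) [kernel_recursion], and such a
    trajectory is determined by its restriction to times k <= n; hence U(w) is
    also the mass of the set of trajectories that agree with X(w) up to time n
    [point_mass_past]. For an event B on the coordinates up to n, the map
    w |-> mu w B is F_n-measurable: the innovations V_k with k > n are
    independent of F_n, so conditioning on them adds nothing to conditioning on
    the V_k with k <= n and F_-oo [conditional_probability_indep,
    law_past_measurable]. Since the state spaces have countable separating
    families of measurable sets, the mass of the set of trajectories that agree
    with X(w) up to n is a limit of masses of cells of finite partitions,
    and so is F_n-measurable as well [measurable_diagonal_mass]. This holds for every n
    [point_mass_measurable].

    U is therefore measurable for the conditioning sigma-algebra, and
    disintegrating the identity mu w {X(w)} = U(w) along mu shows that, for
    almost every w, mu w-almost every point has mass exactly U(w)
    [disintegration_null, kernel_constant_mass]. A probability measure almost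
    all of whose points have the same mass u is diffuse if u = 0, and is uniform
    on 1/u points if u > 0 [diffuse_constant, uniform_constant]. The common mass
    is U and the number of atoms is 1/U, or 0 if U = 0; both are functions of
    U. *)

(** * Sub-sigma-algebras *)

Lemma gen_sigma_algebra (T : Type) (F : set_system T) :
  sigma_algebra setT <<s F >>.
Proof. exact: smallest_sigma_algebra. Qed.

Lemma gen_sub_sigma_algebra (T : Type) (F K : set_system T) :
  sigma_algebra setT K -> F `<=` K -> <<s F >> `<=` K.
Proof. by move=> sK FK; exact: smallest_sub. Qed.

(** The measure m seen on the coarser measurable space (W, <<s F>>). The
    inclusion of sigma-algebras is an argument, so that the measure structure
    can be inferred from the term. *)
Definition coarsen (R : realType) (d : measure_display) (W : measurableType d)
    (F : set_system W) (Fm : <<s F >> `<=` @measurable _ W)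
    (m : set W -> \bar R) : set (g_sigma_algebraType F) -> \bar R := m.

Section coarsen.
Local Open Scope ereal_scope.
Context (R : realType) (d : measure_display) (W : measurableType d).
Variables (F : set_system W) (Fm : <<s F >> `<=` @measurable _ W).

Section measure.
Variable m : {measure set W -> \bar R}.

Let coarsen0 : coarsen Fm m set0 = 0. Proof. exact: measure0. Qed.

Let coarsen_ge0 A : 0 <= coarsen Fm m A. Proof. exact: measure_ge0. Qed.

Let coarsen_sigma_additive : semi_sigma_additive (coarsen Fm m).
Proof.
move=> A mA tA mUA; apply: measure_semi_sigma_additive => //; last exact: Fm.
by move=> i; exact: Fm (mA i).
Qed.

HB.instance Definition _ := isMeasure.Build _ _ _ (coarsen Fm m)
  coarsen0 coarsen_ge0 coarsen_sigma_additive.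
End measure.

Section finite_measure.
Variable m : {finite_measure set W -> \bar R}.

Let coarsen_fin : fin_num_fun (coarsen Fm m).
Proof. by move=> A mA; apply: fin_num_measure; exact: Fm. Qed.

HB.instance Definition _ := Measure_isFinite.Build _ _ _ (coarsen Fm m)
  coarsen_fin.
End finite_measure.

Lemma measurable_id_coarsen :
  measurable_fun [set: W] (id : W -> g_sigma_algebraType F).
Proof. by move=> _ Y mY; rewrite setTI; exact: Fm. Qed.

Lemma coarsen_measurable_fun d' (T : measurableType d') (f : W -> T) :
  measurable_fun [set: g_sigma_algebraType F] f -> measurable_fun [set: W] f.
Proof. by move=> mf; exact: (measurableT_comp mf measurable_id_coarsen). Qed.

Lemma integral_coarsen (m : {measure set W -> \bar R}) (f : W -> \bar R) A :
  <<s F >> A -> measurable_fun [set: g_sigma_algebraType F] f ->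
  (forall w, 0 <= f w) ->
  \int[coarsen Fm m]_(w in A) f w = \int[m]_(w in A) f w.
Proof.
move=> FA mf f0.
rewrite [LHS](@ge0_integral_pushforward _ _ W (g_sigma_algebraType F) _ id)//.
- exact: measurable_id_coarsen.
- exact: measurable_funTS.
Qed.

End coarsen.

Lemma ge0_integral_mrestr (R : realType) (d : measure_display)
    (W : measurableType d) (m : {measure set W -> \bar R}) (A B : set W)
    (mA : measurable A) (f : W -> \bar R) :
  measurable B -> measurable_fun setT f -> (forall w, (0 <= f w)%E) ->
  (\int[mrestr m mA]_(w in B) f w = \int[m]_(w in B `&` A) f w)%E.
Proof.
move=> mB mf f0.
have mCA0 : mrestr m mA (~` A) = 0%E by rewrite /mrestr setICl measure0.
rewrite (ge0_negligible_integral (measurableC mA) mB (measurable_funTS mf)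
  (fun x _ => f0 x) mCA0).
rewrite setDE setCK; apply: eq_measure_integral => C mC CBA.
by rewrite /mrestr/=; congr (m _); apply/setIidl => w /CBA[].
Qed.

(** The measure with density g with respect to m; the hypotheses on g are
    arguments so that the measure structure can be inferred from the term. *)
Definition density (R : realType) (d : measure_display) (W : measurableType d)
    (m : {measure set W -> \bar R}) (g : W -> \bar R)
    (mg : measurable_fun setT g) (g0 : forall w, (0 <= g w)%E) (A : set W) :
    \bar R := (\int[m]_(w in A) g w)%E.

Section density.
Local Open Scope ereal_scope.
Context (R : realType) (d : measure_display) (W : measurableType d).
Variables (m : {measure set W -> \bar R}) (g : W -> \bar R).
Variables (mg : measurable_fun setT g) (g0 : forall w, 0 <= g w).

Let density_set0 : density m mg g0 set0 = 0. Proof. exact: integral_set0. Qed.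

Let density_ge0 A : 0 <= density m mg g0 A. Proof. exact: integral_ge0. Qed.

Let density_sigma_additive : semi_sigma_additive (density m mg g0).
Proof.
move=> A mA tA _; rewrite /density ge0_integral_bigcup//.
- by apply: is_cvg_nneseries => n _ _; exact: integral_ge0.
- exact: measurable_funTS.
Qed.

HB.instance Definition _ := isMeasure.Build _ _ _ (density m mg g0)
  density_set0 density_ge0 density_sigma_additive.
End density.

(** Two measures of finite total mass that agree on a pi-system containing the
    whole space agree on the sigma-algebra it generates. *)
Lemma pi_system_measure_unique (R : realType) (d : measure_display)
    (W : measurableType d) (m1 m2 : {measure set W -> \bar R})
    (C : set_system W) :
  C `<=` measurable -> setI_closed C -> C setT -> (m1 setT < +oo)%E ->
  (forall A, C A -> m1 A = m2 A) -> forall A, <<s C >> A -> m1 A = m2 A.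
Proof.
move=> Cm IC CT m1T m12 A.
apply: (g_sigma_algebra_measure_unique C Cm (fun=> setT)) => //.
by rewrite bigcup_const//; exists 0%N.
Qed.

Section sub_sigma_algebra.
Local Open Scope ereal_scope.
Context (R : realType) (d : measure_display) (W : measurableType d).
Variable P : probability W R.
Variable F : set_system W.
Hypothesis sF : sigma_algebra setT F.
Local Notation WF := (g_sigma_algebraType F).

Lemma measurable_subE (A : set W) : @measurable _ WF A = F A.
Proof. by rewrite /measurable/= sigma_algebra_id. Qed.

Lemma sigma_algebra_setT : F setT.
Proof. by case: sF => F0 FC _; rewrite -(setD0 setT); exact: FC. Qed.

Lemma sigma_algebra_setC A : F A -> F (~` A).
Proof. by case: sF => _ FC _ /FC; rewrite setTD. Qed.

Lemma sigma_algebra_setI A B : F A -> F B -> F (A `&` B).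
Proof. by rewrite -!measurable_subE; exact: measurableI. Qed.

Lemma sigma_algebra_setU A B : F A -> F B -> F (A `|` B).
Proof. by rewrite -!measurable_subE; exact: measurableU. Qed.

(** A function that agrees almost surely with an F-measurable one is itself
    F-measurable as soon as F contains all negligible sets. *)
Lemma ae_eq_sub_measurable (f g : W -> \bar R) :
  P.-negligible `<=` F -> measurable_fun [set: WF] g ->
  {ae P, forall w, f w = g w} -> measurable_fun [set: WF] f.
Proof.
move=> NF mg fg _ Y mY; rewrite setTI.
have mgY : F (g @^-1` Y).
  by rewrite -measurable_subE -[_ @^-1` _]setTI; exact: mg.
pose N := [set w | f w != g w].
have nN : P.-negligible N by apply: negligibleS fg => w /eqP.
rewrite measurable_subE.
have -> : f @^-1` Y = (g @^-1` Y `&` ~` N) `|` (f @^-1` Y `&` N).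
  apply/seteqP; split=> w /=.
    move=> Yfw; have [e|ne] := eqVneq (f w) (g w); last by right.
    by left; split; [rewrite -e|rewrite /N /= e eqxx].
  by case=> [[Yg]|[]//]; rewrite /N/= => /negP; rewrite negbK => /eqP ->.
apply: sigma_algebra_setU.
  by apply: sigma_algebra_setI => //; apply: sigma_algebra_setC; exact: NF.
by apply: NF; apply: negligibleS nN => w [].
Qed.

Hypothesis Fm : F `<=` @measurable _ W.

Lemma sub_measurable : <<s F >> `<=` @measurable _ W.
Proof. by rewrite sigma_algebra_id. Qed.

(** The conditional probability of an event A given F, as a Radon-Nikodym
    density on the coarser space (W, F). *)
Lemma conditional_probability A : @measurable _ W A ->
  exists g : W -> \bar R, [/\ forall w, 0 <= g w, measurable_fun [set: WF] g &
    forall B, F B -> \int[P]_(w in B) g w = P (B `&` A)].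
Proof.
move=> mA.
have [|g [g0 ig gE]] := @radon_nikodym_finite _ WF R
  (coarsen sub_measurable P) (coarsen sub_measurable (mrestr P mA)).
  apply/null_content_dominatesP => B mB PB0.
  have {}mB : @measurable _ W B by exact: sub_measurable.
  apply/eqP; rewrite -measure_le0 -PB0.
  by apply: le_measure; rewrite ?inE//; exact: measurableI.
exists g; split => //; first exact: measurable_int ig.
move=> B FB; have sFB : <<s F >> B by rewrite sigma_algebra_id.
rewrite -(integral_coarsen sub_measurable)//; last exact: measurable_int ig.
by rewrite -gE.
Qed.

Lemma conditional_probability_unique A (f g : W -> \bar R) :
  (forall w, 0 <= f w) -> measurable_fun [set: WF] f ->
  (forall w, 0 <= g w) -> measurable_fun [set: WF] g ->
  (forall B, F B -> \int[P]_(w in B) f w = P (B `&` A)) ->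
  (forall B, F B -> \int[P]_(w in B) g w = P (B `&` A)) ->
  @measurable _ W A -> {ae P, forall w, f w = g w}.
Proof.
move=> f0 mf g0 mg fE gE mA.
have := @integral_ae_eq _ WF R (coarsen sub_measurable P) setT measurableT g f.
case.
- apply/integrableP; split => //.
  under eq_integral do rewrite gee0_abs//.
  rewrite integral_coarsen//; last exact: sub_sigma_algebra sigma_algebra_setT.
  rewrite fE; last exact: sigma_algebra_setT.
  by rewrite setTI (le_lt_trans (probability_le1 _ _))// ltry.
- exact: mg.
- move=> B _; rewrite measurable_subE => FB.
  rewrite !integral_coarsen//; try exact: sub_sigma_algebra.
  by rewrite fE// gE.
- move=> N [mN PN fgN]; exists N; split => //; first exact: sub_measurable.
  by move=> w ne; apply: fgN => /= /(_ I).
Qed.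

End sub_sigma_algebra.

(** If the events of a pi-system C are independent of the sigma-algebra generated
    by H and A, then enlarging H by C leaves the conditional probability of A
    unchanged. The enlarged sigma-algebra G is given by the pi-system of the
    intersections of an event of H with an event of C. *)
Lemma conditional_probability_indep (R : realType) (d : measure_display)
    (W : measurableType d) (P : probability W R) (H C G : set_system W)
    (A : set W) (f : W -> \bar R) :
  sigma_algebra setT H -> sigma_algebra setT G -> G `<=` measurable ->
  measurable A -> setI_closed C -> C setT ->
  G = <<s [set B | exists2 B1, H B1 & exists2 B2, C B2 & B = B1 `&` B2] >> ->
  (forall B1 B2, H B1 -> C B2 -> P (B1 `&` B2) = P B1 * P B2)%E ->
  (forall B1 B2, H B1 -> C B2 ->
    P ((B1 `&` A) `&` B2) = P (B1 `&` A) * P B2)%E ->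
  (forall w, 0 <= f w)%E -> measurable_fun [set: g_sigma_algebraType G] f ->
  (forall B, G B -> \int[P]_(w in B) f w = P (B `&` A))%E ->
  exists2 g : W -> \bar R, measurable_fun [set: g_sigma_algebraType H] g &
    {ae P, forall w, f w = g w}.
Proof.
move=> sH sG Gm mA IC CT GE HC HAC f0 mf fE.
set Pi := (X in <<s X>>) in GE.
have HG : H `<=` G.
  move=> B HB; rewrite GE; apply: sub_sigma_algebra.
  by exists B => //; exists setT => //; rewrite setIT.
have CG : C `<=` G.
  move=> B CB; rewrite GE; apply: sub_sigma_algebra.
  by exists setT; [exact: sigma_algebra_setT|exists B => //; rewrite setTI].
have Hm : H `<=` @measurable _ W by move=> B /HG /Gm.
have sHm := sub_measurable sH Hm.
have sGm := sub_measurable sG Gm.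
have [g [g0 mg gE]] := conditional_probability P sH Hm mA.
exists g => //.
have mgW : measurable_fun [set: W] g := coarsen_measurable_fun sHm mg.
have mgG : measurable_fun [set: g_sigma_algebraType G] g.
  move=> _ Y mY; rewrite (measurable_subE sG); apply: HG.
  by rewrite -(measurable_subE sH); exact: mg.
apply: (conditional_probability_unique sG Gm f0 mf g0 mgG fE _ mA) => B GB.
rewrite GE in GB.
have Gset B1 B2 : H B1 -> C B2 -> G (B1 `&` B2).
  by move=> /HG GB1 /CG GB2; exact: sigma_algebra_setI.
apply: (pi_system_measure_unique (m1 := density P mgW g0) (m2 := mrestr P mA)
  (C := Pi)) GB.
- by move=> _ [B1 HB1 [B2 CB2 ->]]; apply/Gm/Gset.
- move=> _ _ [B1 HB1 [B2 CB2 ->]] [B1' HB1' [B2' CB2' ->]].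
  exists (B1 `&` B1'); first exact: sigma_algebra_setI.
  by exists (B2 `&` B2'); [exact: IC|rewrite setIACA].
- by exists setT; [exact: sigma_algebra_setT|exists setT; rewrite ?setIT].
- rewrite /= /density gE; last exact: sigma_algebra_setT.
  by rewrite setTI (le_lt_trans (probability_le1 _ _))// ltry.
move=> _ [B1 HB1 [B2 CB2 ->]].
have mB1 := Hm _ HB1; have mB2 := Gm _ (CG _ CB2).
rewrite /= /density /mrestr setIAC HAC// -gE//.
(* on H, the trace of P on B2 is P scaled by P B2, and g is H-measurable *)
rewrite -(ge0_integral_mrestr P mB2 mB1 mgW g0).
have -> : (\int[mrestr P mB2]_(w in B1) g w =
    \int[coarsen sHm (mrestr P mB2)]_(w in B1) g w)%E.
  by rewrite integral_coarsen//; exact: sub_sigma_algebra.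
have P20 : (0 <= fine (P B2))%R by exact: fine_ge0.
rewrite (eq_measure_integral (mscale (NngNum P20) (coarsen sHm P))).
  rewrite ge0_integral_mscale//=; first last.
  - exact: measurable_funTS.
  - by rewrite (measurable_subE sH).
  rewrite fineK ?fin_num_measure// muleC; congr (_ * _)%E.
  by rewrite integral_coarsen//; exact: sub_sigma_algebra.
move=> D; rewrite (measurable_subE sH) => HD _.
by rewrite /= /mscale/= fineK ?fin_num_measure// muleC -HC.
Qed.
(** * Generated and completed sigma-algebras *)

Lemma preimage_measurable (d1 d2 : measure_display) (T1 : measurableType d1)
    (T2 : measurableType d2) (h : T1 -> T2) (B : set T2) :
  measurable_fun setT h -> measurable B -> measurable (h @^-1` B).
Proof. by move=> mh mB; rewrite -[_ @^-1` _]setTI; exact: mh. Qed.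

Lemma sigma_of_gen (W I : Type) (dT : I -> measure_display)
    (T : forall i, measurableType (dT i)) (Y : forall i, W -> T i)
    (D : set I) i (C : set (T i)) :
  D i -> measurable C -> sigma_of Y D (Y i @^-1` C).
Proof.
move=> Di mC; apply: sub_sigma_algebra; exists i => //.
by exists C => //; rewrite setTI.
Qed.

Lemma sigma_of_sub (W I : Type) (dT : I -> measure_display)
    (T : forall i, measurableType (dT i)) (Y : forall i, W -> T i)
    (D : set I) (K : set_system W) : sigma_algebra setT K ->
  (forall i (C : set (T i)), D i -> measurable C -> K (Y i @^-1` C)) ->
  sigma_of Y D `<=` K.
Proof.
move=> sK YK; apply: gen_sub_sigma_algebra => // _ [i Di [C mC <-]].
by rewrite setTI; exact: YK.
Qed.

Lemma sigma_of_algebra (W I : Type) (dT : I -> measure_display)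
    (T : forall i, measurableType (dT i)) (Y : forall i, W -> T i) (D : set I) :
  sigma_algebra setT (sigma_of Y D).
Proof. exact: gen_sigma_algebra. Qed.

Lemma measure_eq_negligible (R : realType) (d : measure_display)
    (W : measurableType d) (P : {measure set W -> \bar R}) (A B : set W) :
  measurable A -> measurable B ->
  P.-negligible (A `\` B) -> P.-negligible (B `\` A) -> P A = P B.
Proof.
suff le (C D : set W) : measurable C -> measurable D ->
    P.-negligible (C `\` D) -> (P C <= P D)%E.
  by move=> mA mB AB BA; apply/eqP; rewrite eq_le !le.
move=> mC mD /(measure_negligible (measurableD mC mD)) CD0.
rewrite (@le_trans _ _ (P (D `|` (C `\` D))))//.
  apply: le_measure; rewrite ?inE//.
    by apply: measurableU => //; exact: measurableD.
  by move=> w Cw; have [|nDw] := pselect (D w); [left|right].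
by rewrite (le_trans (measureU2 _ _ _))// ?CD0 ?adde0//; exact: measurableD.
Qed.

Section completion.
Local Open Scope ereal_scope.
Context (R : realType) (d : measure_display) (W : measurableType d).
Variable P : probability W R.

Lemma completion_algebra (F : set_system W) :
  sigma_algebra setT (completion P F).
Proof. exact: gen_sigma_algebra. Qed.

Lemma sub_completion (F : set_system W) : F `<=` completion P F.
Proof. by move=> A FA; apply: sub_sigma_algebra; left. Qed.

Lemma negligible_completion (F : set_system W) :
  P.-negligible `<=` completion P F.
Proof. by move=> A FA; apply: sub_sigma_algebra; right. Qed.

Lemma completion_sub_measurable (F : set_system W) : measure_is_complete P ->
  F `<=` measurable -> completion P F `<=` measurable.
Proof.
move=> cP Fm; apply: gen_sub_sigma_algebra => //.
  exact: sigma_algebra_measurable.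
by move=> A [/Fm|/cP].
Qed.

(** Every event of the completion of F differs from an event of F by a
    negligible set. *)
Lemma completionP (F : set_system W) (A : set W) : sigma_algebra setT F ->
  completion P F A -> exists A', [/\ F A', P.-negligible (A `\` A') &
    P.-negligible (A' `\` A)].
Proof.
move=> sF; apply: (@gen_sub_sigma_algebra _ _ [set A | exists A', [/\ F A',
  P.-negligible (A `\` A') & P.-negligible (A' `\` A)]]); last first.
  move=> B [FB|nB]; first by exists B; rewrite setDv; split => //;
    exact: negligible_set0.
  exists set0; rewrite setD0 set0D; split => //; first by case: sF.
  exact: negligible_set0.
split.
- exists set0; rewrite setDv; case: sF => ? _ _.
  by split => //; exact: negligible_set0.
- move=> B [B' [FB' n1 n2]]; exists (~` B').
  rewrite setTD; split; first exact: sigma_algebra_setC.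
    by apply: negligibleS n2 => w [nB /contrapT].
  by apply: negligibleS n1 => w [nB /contrapT].
move=> B /choice[B' /all_and3[FB' n1 n2]].
exists (\bigcup_k B' k); split; first by case: sF => _ _; exact.
  apply: negligibleS (negligible_bigcup n1) => w [[k _ Bkw] nB'].
  by exists k => //; split => // B'kw; apply: nB'; exists k.
apply: negligibleS (negligible_bigcup n2) => w [[k _ Bkw] nB'].
by exists k => //; split => // B'kw; apply: nB'; exists k.
Qed.

Lemma independent_completion (F G : set_system W) : measure_is_complete P ->
  sigma_algebra setT F -> F `<=` measurable -> G `<=` measurable ->
  independent P G F -> independent P G (completion P F).
Proof.
move=> cP sF Fm Gm GF A B GA FB.
have mB := completion_sub_measurable cP Fm FB.
have [B' [FB' n1 n2]] := completionP sF FB.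
rewrite (measure_eq_negligible mB (Fm _ FB') n1 n2) -GF//.
apply: measure_eq_negligible.
- by apply: measurableI; [exact: Gm|].
- by apply: measurableI; [exact: Gm|exact: Fm].
- by apply: negligibleS n1 => w [[Aw Bw]] nAB; split => // B'w; exact: nAB.
- by apply: negligibleS n2 => w [[Aw Bw]] nAB; split => // B'w; exact: nAB.
Qed.

End completion.

(** * Constructive chains *)

Section chain.
Local Open Scope ereal_scope.
Context (R : realType) (d : measure_display) (W : measurableType d).
Variable P : probability W R.
Hypothesis P_complete : measure_is_complete P.
Context (dE dG : int -> measure_display).
Variables (E : forall n, measurableType (dE n)).
Variables (G : forall n, measurableType (dG n)).
Variables (X : forall n, W -> E n) (V : forall n, W -> G n).
Variable f : forall n, (E n * G (n + 1)%R)%type -> E (n + 1)%R.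
Hypothesis XVf : constructive_chain P X V f.
Local Notation XV := (pair_process X V).
Local Notation Finf := (remote_past P XV).
Local Notation Fall := (join_sigma (sigma_of V setT) Finf).

Let mX n : measurable_fun setT (X n).
Proof. exact: (chain_measurable_X XVf). Qed.
Let mV n : measurable_fun setT (V n).
Proof. exact: (chain_measurable_V XVf). Qed.

Lemma past_algebra n : sigma_algebra setT (past P XV n).
Proof. exact: completion_algebra. Qed.

Lemma pair_measurable D : sigma_of XV D `<=` measurable.
Proof.
apply: sigma_of_sub; first exact: sigma_algebra_measurable.
move=> n C _ mC; apply: (preimage_measurable (h := XV n)) => //.
exact: measurable_fun_pair.
Qed.

Lemma V_measurable D : sigma_of V D `<=` measurable.
Proof.
apply: sigma_of_sub; first exact: sigma_algebra_measurable.
by move=> n C _ mC; exact: preimage_measurable.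
Qed.

Lemma past_measurable n : past P XV n `<=` measurable.
Proof. by apply: completion_sub_measurable => //; exact: pair_measurable. Qed.

Lemma past_X n k (C : set (E k)) :
  (k <= n)%R -> measurable C -> past P XV n (X k @^-1` C).
Proof.
move=> kn mC; apply: sub_completion.
have -> : X k @^-1` C = XV k @^-1` (C `*` setT).
  by apply/seteqP; split => w //= [].
by apply: sigma_of_gen => //; exact: measurableX.
Qed.

Lemma past_V n k (C : set (G k)) :
  (k <= n)%R -> measurable C -> past P XV n (V k @^-1` C).
Proof.
move=> kn mC; apply: sub_completion.
have -> : V k @^-1` C = XV k @^-1` (setT `*` C).
  by apply/seteqP; split => w //= [].
by apply: sigma_of_gen => //; exact: measurableX.
Qed.

Lemma past_mono n m : (n <= m)%R -> past P XV n `<=` past P XV m.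
Proof.
move=> nm; apply: gen_sub_sigma_algebra; first exact: past_algebra.
move=> A [|nA]; last exact: negligible_completion.
move: A; apply: sigma_of_sub; first exact: past_algebra.
move=> k C /= kn mC; apply: sub_completion; apply: sigma_of_gen => //=.
exact: le_trans nm.
Qed.

Lemma remote_past_algebra : sigma_algebra setT Finf.
Proof.
split.
- by move=> n _; case: (past_algebra n).
- by move=> A FA n _; case: (past_algebra n) => _ FC _; apply: FC; exact: FA.
- move=> A FA n _; case: (past_algebra n) => _ _ FU.
  by apply: FU => k; exact: FA.
Qed.

Lemma negligible_remote_past : P.-negligible `<=` Finf.
Proof. by move=> A nA n _; exact: negligible_completion. Qed.

Lemma all_algebra : sigma_algebra setT Fall.
Proof. exact: gen_sigma_algebra. Qed.

Lemma all_measurable : Fall `<=` measurable.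
Proof.
apply: gen_sub_sigma_algebra; first exact: sigma_algebra_measurable.
move=> A [/V_measurable//|]; move/(_ 0%R I); exact: past_measurable.
Qed.

(** The event that V_(n+i+1) belongs to C i for every i < j. The index n + i + 1
    is written as the successor of n + i, the form in which the independence of
    the innovation at time n + i + 1 is stated. *)
Definition future_cylinder (n : int)
    (C : forall i : nat, set (G (n + i%:Z + 1)%R)) (j : nat) : set W :=
  [set w | forall i, (i < j)%N -> C i (V (n + i%:Z + 1)%R w)].

(** The pi-system of the events on finitely many innovations after time n. *)
Definition future_cylinders (n : int) : set_system W :=
  [set A | exists2 C : forall i : nat, set (G (n + i%:Z + 1)%R),
    (forall i, measurable (C i)) & exists j, A = future_cylinder C j].

Lemma future_cylinder0 (n : int)
    (C : forall i : nat, set (G (n + i%:Z + 1)%R)) :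
  future_cylinder C 0 = setT.
Proof. by apply/seteqP; split. Qed.

Lemma future_cylinderS (n : int)
    (C : forall i : nat, set (G (n + i%:Z + 1)%R)) j :
  future_cylinder C j.+1 =
  future_cylinder C j `&` (V (n + j%:Z + 1)%R @^-1` C j).
Proof.
apply/seteqP; split => w /= h.
  by split; [move=> i ij; apply: h; exact: ltnW|exact: h].
move=> i; rewrite ltnS leq_eqVlt => /orP[/eqP ->|]; first by case: h.
by move=> ij; case: h => + _; exact.
Qed.

Lemma past_future_cylinder (n : int)
    (C : forall i : nat, set (G (n + i%:Z + 1)%R)) j :
  (forall i, measurable (C i)) -> past P XV (n + j%:Z)%R (future_cylinder C j).
Proof.
move=> mC; elim: j => [|j IH].
  by rewrite future_cylinder0; exact: sigma_algebra_setT (past_algebra _).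
rewrite future_cylinderS; apply: (sigma_algebra_setI (past_algebra _)).
  by apply: past_mono IH; rewrite lerD2l lez_nat.
by apply: past_V => //; rewrite -addrA lerD2l -addn1 PoszD.
Qed.

(** The innovations after time n are jointly independent of F_n: each one is
    independent of the past that contains the previous ones. *)
Lemma independent_future (n : int)
    (C : forall i : nat, set (G (n + i%:Z + 1)%R)) j A :
  (forall i, measurable (C i)) -> past P XV n A ->
  P (A `&` future_cylinder C j) = P A * P (future_cylinder C j).
Proof.
move=> mC; elim: j A => [|j IH] A FA.
  by rewrite future_cylinder0 setIT probability_setT mule1.
have Vind B : past P XV (n + j%:Z)%R B ->
    P (B `&` (V (n + j%:Z + 1)%R @^-1` C j)) =
    P B * P (V (n + j%:Z + 1)%R @^-1` C j).
  move=> FB; rewrite setIC muleC.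
  apply: (independent_completion (F := sigma_of XV [set k | (k <= n + j%:Z)%R])
    (G := sigma_of V [set (n + j%:Z + 1)%R])) => //.
  - exact: sigma_of_algebra.
  - exact: pair_measurable.
  - exact: V_measurable.
  - exact: (chain_independent XVf).
  - exact: sigma_of_gen.
have Fj := @past_future_cylinder n C j mC.
rewrite future_cylinderS setIA !Vind ?IH ?muleA//.
apply: (sigma_algebra_setI (past_algebra _)) => //.
by apply: past_mono FA; rewrite lerDl lez_nat.
Qed.

Lemma future_cylinders_setI n : setI_closed (future_cylinders n).
Proof.
move=> _ _ [C mC [j ->]] [C' mC' [j' ->]].
pose K i := (if (i < j)%N then C i else setT) `&`
            (if (i < j')%N then C' i else setT).
exists K; first by move=> i; apply: measurableI; case: ifP.
exists (maxn j j'); apply/seteqP; split => w /=.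
  by move=> [h h'] i _; split; case: ifPn => // ?; [exact: h|exact: h'].
move=> h; split => i ij.
  by have := h i; rewrite /K ij leq_max ij => /(_ isT)[].
by have := h i; rewrite /K ij leq_max ij orbT => /(_ isT)[].
Qed.

Lemma future_cylinders_setT n : future_cylinders n setT.
Proof.
by exists (fun=> setT) => //; exists 0%N; rewrite future_cylinder0.
Qed.

(** The sigma-algebra generated by F_-oo and the innovations up to time n: the
    part of sigma(V) \/ F_-oo that is known at time n. *)
Definition known (n : int) : set_system W :=
  join_sigma (sigma_of V [set k | (k <= n)%R]) Finf.

Lemma known_past n : known n `<=` past P XV n.
Proof.
apply: gen_sub_sigma_algebra; first exact: past_algebra.
move=> A [|/(_ n I)//]; move: A; apply: sigma_of_sub.
  exact: past_algebra.
by move=> k C kn mC; exact: past_V.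
Qed.

Lemma known_all n : known n `<=` Fall.
Proof.
apply: gen_sub_sigma_algebra; first exact: all_algebra.
move=> A [|FA]; last by apply: sub_sigma_algebra; right.
move: A; apply: sigma_of_sub; first exact: all_algebra.
by move=> k C _ mC; apply: sub_sigma_algebra; left; exact: sigma_of_gen.
Qed.

Lemma all_known_future n : Fall =
  <<s [set B | exists2 B1, known n B1 & exists2 B2, future_cylinders n B2 &
    B = B1 `&` B2] >>.
Proof.
set Pi := (X in <<s X >>).
have PiK : known n `<=` <<s Pi >>.
  move=> A kA; apply: sub_sigma_algebra; exists A => //; exists setT.
    exact: future_cylinders_setT.
  by rewrite setIT.
apply/seteqP; split.
  apply: gen_sub_sigma_algebra; first exact: gen_sigma_algebra.
  move=> A [|FA]; last by apply: PiK; apply: sub_sigma_algebra; right.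
  move: A; apply: sigma_of_sub; first exact: gen_sigma_algebra.
  move=> k C _ mC; have [kn|nk] := leP k n.
    by apply: PiK; apply: sub_sigma_algebra; left; exact: sigma_of_gen.
  have [i ki] : exists i : nat, k = (n + i%:Z + 1)%R.
    exists `|(k - n - 1)%R|%N; rewrite gez0_abs; last first.
      by rewrite subr_ge0 lerBrDr addrC lezD1.
    by rewrite addrA subrK addrC subrK.
  subst k; apply: sub_sigma_algebra; exists setT.
    exact: sigma_algebra_setT (gen_sigma_algebra _).
  exists (V (n + i%:Z + 1)%R @^-1` C); last by rewrite setTI.
  (* the family of events is C at index i and trivial elsewhere *)
  pose K j : set (G (n + j%:Z + 1)%R) :=
    if pselect (i = j) is left e
    then eq_rect i (fun j => set (G (n + j%:Z + 1)%R)) C j e else setT.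
  exists K; first by rewrite /K => j; case: pselect => // e; case: _ / e.
  exists i.+1; apply/seteqP; split => w /=.
    by move=> Cw j _; rewrite /K; case: pselect => // e; case: _ / e.
  move=> /(_ i (ltnSn i)); rewrite /K; case: pselect => // e.
  by rewrite (Prop_irrelevance e erefl).
apply: gen_sub_sigma_algebra; first exact: all_algebra.
move=> _ [A /known_all FA [_ [C mC [j ->]] ->]].
apply: (sigma_algebra_setI all_algebra) => // {A FA}.
elim: j => [|j IH].
  by rewrite future_cylinder0; exact: sigma_algebra_setT all_algebra.
rewrite future_cylinderS; apply: (sigma_algebra_setI all_algebra) => //.
by apply: sub_sigma_algebra; left; exact: sigma_of_gen.
Qed.

Section conditional_law.
Variable mu : R.-pker (g_sigma_algebraType Fall) ~> product_space E.
Let Z (w : W) : product_space E := fun n : int => X n w.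
Hypothesis mu_law : is_conditional_law P Z mu.

(** Given what is known at time n, the later innovations carry no information
    on the past: the conditional probability of an event of F_n depending on X
    only is F_n-measurable, although all of V is given. *)
Lemma law_past_measurable n (B : set (product_space E)) :
  measurable B -> past P XV n (Z @^-1` B) ->
  measurable_fun [set: g_sigma_algebraType (past P XV n)] (mu ^~ B).
Proof.
move=> mB FB.
have mA : measurable (Z @^-1` B) by exact: past_measurable FB.
have sk : sigma_algebra setT (known n) := gen_sigma_algebra _.
have [|||||g mg fg] := conditional_probability_indep (P := P) (H := known n)
  (C := future_cylinders n) (G := Fall) (A := Z @^-1` B) (f := mu ^~ B)
  sk all_algebra all_measurable mA (@future_cylinders_setI n)
  (future_cylinders_setT n) (all_known_future n).
- move=> A _ /known_past FA [C mC [j ->]]; exact: independent_future.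
- move=> A _ /known_past FA [C mC [j ->]]; apply: independent_future => //.
  exact: (sigma_algebra_setI (past_algebra _)).
- by move=> w; exact: measure_ge0.
- exact: measurable_kernel.
- by move=> A FA; rewrite mu_law.
apply: (ae_eq_sub_measurable (past_algebra n) _ _ fg).
  exact: negligible_completion.
move=> _ Y mY; rewrite (measurable_subE (past_algebra n)); apply: known_past.
by rewrite -(measurable_subE sk); exact: mg.
Qed.

End conditional_law.

End chain.

(** * Disintegration along a conditional law *)

Lemma measurable_setP (d : measure_display) (T : measurableType d)
    (A : set T) (p : Prop) :
  measurable A -> measurable [set x | A x <-> p].
Proof.
move=> mA; have [hp|np] := pselect p.
  by rewrite (_ : [set x | _] = A)//; apply/seteqP; split => x /=; tauto.
rewrite (_ : [set x | _] = ~` A); first exact: measurableC.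
by apply/seteqP; split => x /=; tauto.
Qed.

(** The mass that a kernel gives to the set of points that the sets C i do not
    separate from x(z) depends measurably on z. The kernel need only be
    measurable on the sets whose preimage by x is measurable. *)
Lemma measurable_diagonal_mass (R : realType) (dZ dT : measure_display)
    (Z : measurableType dZ) (T : measurableType dT)
    (m : Z -> {measure set T -> \bar R}) (x : Z -> T) (C : nat -> set T) :
  (forall z, m z setT < +oo)%E ->
  (forall i, measurable (C i)) -> (forall i, measurable (x @^-1` C i)) ->
  (forall B, measurable B -> measurable (x @^-1` B) ->
    measurable_fun setT (m ^~ B)) ->
  measurable_fun setT (fun z => m z [set y | forall i, C i y <-> C i (x z)]).
Proof.
move=> mT mC mxC mm.
pose cell j z := [set y | forall i, (i < j)%N -> (C i y <-> C i (x z))].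
have cellS j z : cell j.+1 z = cell j z `&` [set y | C j y <-> C j (x z)].
  apply/seteqP; split => y /= h.
    by split; [move=> i ij; apply: h; exact: ltnW|exact: h].
  move=> i; rewrite ltnS leq_eqVlt => /orP[/eqP ->|]; first by case: h.
  by move=> ij; case: h => + _; exact.
have mcell j z : measurable (cell j z).
  elim: j => [|j IH]; last first.
    by rewrite cellS; apply: measurableI => //; exact: measurable_setP.
  by rewrite (_ : cell _ _ = setT)//; apply/seteqP; split.
have mcellB j B : measurable B -> measurable (x @^-1` B) ->
    measurable_fun setT (fun z => m z (B `&` cell j z)).
  elim: j B => [|j IH] B mB mxB.
    rewrite (_ : (fun z => _) = m ^~ B); first exact: mm.
    apply/funext => z; congr (m z _).
    by apply/seteqP; split => y //= [].
  rewrite (_ : (fun z => _) = (fun z => if `[< C j (x z) >] then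
    m z ((B `&` C j) `&` cell j z) else m z ((B `&` ~` C j) `&` cell j z))).
    apply: measurable_fun_ifT.
    - apply: (measurable_fun_bool true); rewrite setTI.
      rewrite (_ : _ @^-1` _ = x @^-1` C j)//.
      by apply/seteqP; split => z /=; [move/asboolP|move=> h; apply/asboolP].
    - apply: IH; first exact: measurableI.
      by rewrite preimage_setI; exact: measurableI.
    - apply: IH; first by apply: measurableI => //; exact: measurableC.
      by rewrite preimage_setI; exact: measurableI mxB (measurableC (mxC j)).
  apply/funext => z; rewrite cellS.
  (* the cell of x z is cut by C j on the side where x z lies *)
  case: asboolP => Cz; congr (m z _); apply/seteqP; split => y /=; tauto.
apply: (emeasurable_fun_cvg (fun j z => m z (setT `&` cell j z))).
  by move=> j; apply: mcellB => //; rewrite preimage_setT.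
move=> z _; under eq_fun do rewrite setTI.
rewrite (_ : [set y | _] = \bigcap_j cell j z); last first.
  apply/seteqP; split => y /= h; first by move=> j _ i _.
  by move=> i; exact: (h i.+1 I i).
apply: nonincreasing_cvg_mu.
- by rewrite (le_lt_trans _ (mT z))// le_measure ?inE.
- by [].
- exact: bigcapT_measurable.
- move=> i j ij; apply/subsetPset => y h k ki; apply: h.
  exact: leq_trans ij.
Qed.

(** The law of the pair (h w, y), where w has law P and y is drawn from the
    kernel mu at h w. The measurability of h is an argument so that the measure
    structure can be inferred from the term. *)
Definition joint_law (R : realType) (d1 d2 d3 : measure_display)
    (W : measurableType d1) (W1 : measurableType d2) (T : measurableType d3)
    (P : {measure set W -> \bar R}) (h : W -> W1)
    (mh : measurable_fun setT h) (mu : R.-fker W1 ~> T)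
    (D : set (W1 * T)) : \bar R :=
  (\int[P]_w mu (h w) (xsection D (h w)))%E.

Section joint_law.
Local Open Scope ereal_scope.
Context (R : realType) (d1 d2 d3 : measure_display).
Context (W : measurableType d1) (W1 : measurableType d2).
Context (T : measurableType d3).
Variables (P : {measure set W -> \bar R}) (h : W -> W1).
Variables (mh : measurable_fun setT h) (mu : R.-fker W1 ~> T).

Let joint0 : joint_law P mh mu set0 = 0.
Proof. by apply: integral0_eq => w _; rewrite xsection0 measure0. Qed.

Let joint_ge0 D : 0 <= joint_law P mh mu D.
Proof. by apply: integral_ge0 => w _; exact: measure_ge0. Qed.

Lemma measurable_xsection_mass (D : set (W1 * T)) : measurable D ->
  measurable_fun setT (fun w => mu (h w) (xsection D (h w))).
Proof.
move=> mD; apply: (measurableT_comp (f := fun z => mu z (xsection D z))) => //.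
by apply: measurable_fun_xsection_finite_kernel; rewrite inE.
Qed.

Let joint_sigma_additive : semi_sigma_additive (joint_law P mh mu).
Proof.
move=> D mD tD mUD.
rewrite [X in _ --> X](_ : _ = \sum_(n <oo) joint_law P mh mu (D n)).
  by apply/cvg_closeP; split; [exact: is_cvg_nneseries|rewrite closeE].
rewrite -integral_nneseries//; last first.
  by move=> n; exact: measurable_xsection_mass.
apply: eq_integral => w _; apply/esym/cvg_lim => //=; rewrite xsection_bigcup.
apply: (measure_sigma_additive _ (trivIset_xsection tD)) => n.
exact: measurable_xsection.
Qed.

HB.instance Definition _ := isMeasure.Build _ _ _ (joint_law P mh mu)
  joint0 joint_ge0 joint_sigma_additive.
End joint_law.

Section disintegration.
Local Open Scope ereal_scope.
Context (R : realType) (d dT : measure_display).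
Context (W : measurableType d) (T : measurableType dT).
Variables (P : probability W R) (F : set_system W).
Hypothesis sF : sigma_algebra setT F.
Hypothesis Fm : F `<=` measurable.
Local Notation WF := (g_sigma_algebraType F).
Variables (Z : W -> T) (mu : R.-pker WF ~> T).
Hypothesis mZ : measurable_fun setT Z.
Hypothesis mu_law : is_conditional_law P Z mu.

Let mid : measurable_fun setT (id : W -> WF).
Proof. by apply: measurable_id_coarsen; exact: sub_measurable. Qed.

(** The graph of Z, as a random variable in the product space. *)
Let graph (w : W) : WF * T := (w, Z w).
Let mgraph : measurable_fun setT graph.
Proof. exact: measurable_fun_pair. Qed.

HB.instance Definition _ := isMeasurableFun.Build _ _ _ _ graph mgraph.

(** The joint law of w and Z is recovered by drawing w and then a point from
    the conditional law of Z at w. *)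
Lemma disintegration (D : set (WF * T)) : measurable D ->
  \int[P]_w mu w (xsection D w) = P [set w | D (w, Z w)].
Proof.
move=> mD.
apply: (pi_system_measure_unique (m1 := joint_law P mid mu)
  (m2 := distribution P graph)
  (C := [set A `*` B | A in measurable & B in measurable])).
- by move=> _ [A mA [B mB <-]]; exact: measurableX.
- move=> _ _ [A mA [B mB <-]] [A' mA' [B' mB' <-]].
  exists (A `&` A'); first exact: measurableI.
  by exists (B `&` B'); [exact: measurableI|rewrite setXI].
- by exists setT => //; exists setT => //; rewrite setXTT.
- rewrite /= /joint_law.
  under eq_integral do rewrite xsectionE preimage_setT prob_kernel.
  rewrite integral_cst// mul1e.
  exact: le_lt_trans (probability_le1 P measurableT) (ltry 1).
- move=> _ [A mA [B mB <-]]; rewrite measurable_subE// in mA.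
  rewrite /= /joint_law.
  transitivity (\int[P]_(w in A) mu w B).
    rewrite [RHS]integral_mkcond; apply: eq_integral => w _.
    rewrite patchE; case: ifPn => wA; first by rewrite in_xsectionX.
    by rewrite notin_xsectionX// measure0.
  by rewrite mu_law.
- by rewrite -measurable_prod_measurableType.
Qed.

(** If the graph of Z almost surely avoids D, then almost every measure mu w
    gives mass zero to the section of D at w. *)
Lemma disintegration_null (D : set (WF * T)) : measurable D ->
  {ae P, forall w, ~ D (w, Z w)} ->
  {ae P, forall w : W, mu w (xsection D w) = 0}.
Proof.
move=> mD nD.
have mDw : measurable_fun setT (fun w : W => mu w (xsection D w)).
  exact: (measurable_xsection_mass mid).
have : \int[P]_w mu w (xsection D w) = 0.
  rewrite disintegration//; apply: measure_negligible; last first.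
    by apply: negligibleS nD => w /= Dw; exact.
  by rewrite -[X in measurable X]setTI; exact: mgraph.
move=> I0; have := (ae_eq_integral_abs P measurableT mDw).1.
under eq_integral do rewrite gee0_abs//.
by move=> /(_ I0); apply: filterS => w /= /(_ I).
Qed.

End disintegration.

(** * Measures whose atoms carry a constant mass *)

Section constant_atoms.
Local Open Scope ereal_scope.
Context (R : realType) (d : measure_display) (T : measurableType d).
Variable m : {measure set T -> \bar R}.
Hypothesis mT : m setT = 1.
Hypothesis m1 : forall x : T, measurable [set x].
Variable u : R.
Hypothesis mS : measurable [set x | m [set x] = u%:E].
Hypothesis mS0 : m [set x | m [set x] <> u%:E] = 0.

Let S : set T := [set x | m [set x] = u%:E].

Lemma atoms_constant x : atoms m x -> m [set x] = u%:E.
Proof.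
rewrite /atoms/= => mx; apply: contrapT => ne; move: mx.
rewrite ltNge => /negP; apply.
rewrite -mS0; apply: le_measure; rewrite ?inE//; first exact: measurableC mS.
by move=> _ ->.
Qed.

Lemma diffuse_constant : u = 0%R -> diffuse m.
Proof.
move=> u0; apply/seteqP; split => // x mx; move: (mx).
by rewrite /atoms/= (atoms_constant mx) u0 ltxx.
Qed.

Hypothesis u_gt0 : (0 < u)%R.

Lemma finite_set_mass (B : set T) : finite_set B -> B `<=` S ->
  m B = (#|` fset_set B|%:R * u)%:E.
Proof.
move=> fB BS; have BE : B = \bigcup_(x in B) [set x].
  by apply/seteqP; split => [x Bx|x [y By ->//]]; exists x.
rewrite {1}BE measure_fin_bigcup//.
  rewrite fsbig_finite//= big_seq (eq_bigr (fun=> u%:E)); last first.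
    by move=> x; rewrite in_fset_set// inE => /BS.
  rewrite -big_seq sumEFin big_const_seq count_predT iter_addr_0.
  by rewrite mulr_natl.
by apply/trivIsetP => x y _ _ xy; apply/seteqP; split => z //= [-> e];
  rewrite e eqxx in xy.
Qed.

Lemma atoms_eq : atoms m = S.
Proof.
apply/seteqP; split => x; first exact: atoms_constant.
by rewrite /S/= => e; rewrite /atoms/= e lte_fin.
Qed.

Lemma finite_atoms : finite_set S.
Proof.
apply: contrapT => iS.
pose N := (Num.truncn u^-1).+1.
have [B BS NB] := infinite_set_fset N iS.
have : m [set` B] <= 1.
  rewrite -mT; apply: le_measure; rewrite ?inE//.
  by apply: countable_measurable => //; exact: countable_fset.
rewrite finite_set_mass// set_fsetK lee_fin leNgt => /negP; apply.
rewrite -(ltr_pdivrMr _ _ u_gt0) mul1r.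
by rewrite (lt_le_trans (truncnS_gt _))// ler_nat.
Qed.

Let mS1 : m S = 1.
Proof.
have mCS : m (~` S) = 0 := mS0.
rewrite -mT -(setUv S) measureU//.
- by rewrite -[LHS]adde0; congr (_ + _); exact: esym mCS.
- exact: measurableC.
- exact: setICr.
Qed.

Lemma card_atoms : (#|` fset_set S|%:R)%R = u^-1%R :> R.
Proof.
have := mS1; rewrite finite_set_mass//; last exact: finite_atoms.
by move=> [e]; apply: (mulIf (lt0r_neq0 u_gt0)); rewrite e mulVf// lt0r_neq0.
Qed.

Lemma uniform_constant : uniform_on_finite_set m.
Proof.
exists S; split; first exact: finite_atoms.
  apply/set0P/negP => /eqP S0; have := mS1; rewrite S0 measure0.
  by move=> /esym/eqP; rewrite onee_eq0.
move=> B mB; rewrite card_atoms invrK -finite_set_mass; last 2 first.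
- exact: finite_setIl finite_atoms.
- by move=> x [].
have -> : m B = m (B `\` S) + m (B `&` S) by exact: measureDI.
rewrite setIC (subset_measure0 _ _ _ mS0) ?add0e//.
- exact: measurableD.
- exact: measurableC mS.
Qed.

Lemma number_of_atoms_constant : number_of_atoms m = (u^-1)%:E.
Proof.
rewrite /number_of_atoms atoms_eq /counting asboolT; last exact: finite_atoms.
by rewrite card_atoms.
Qed.

End constant_atoms.

(** * Separating sequences of measurable sets *)

(** In a standard Borel space, the traces of a countable basis of open sets
    separate the points. *)
Lemma standard_borel_separated (R : realType) (d : measure_display)
    (T : measurableType d) : standard_borel R T ->
  exists D : nat -> set T, (forall i, measurable (D i)) /\
    forall x y, (forall i, D i x <-> D i y) -> x = y.
Proof.
move=> [Y [phi [[hY [B cB [Bo Bb]]] inj_phi _ mT]]].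
have [B0|[g]] := pfcard_geP cB.
  have [U [BU _] _] := Bb (phi point) setT filterT.
  by rewrite B0 in BU.
have gB i : B (g i) by exact: funS.
exists (fun i => phi @^-1` g i); split.
  move=> i; rewrite mT; exists (g i); last by rewrite setTI.
  by apply: sub_sigma_algebra; exact: Bo.
move=> x y xy; apply: inj_phi; apply: hY => U V nU nV.
have [U' [/= BU' U'x] U'U] := Bb _ _ nU.
have [i _ gi] := surj (f := g) BU'.
exists (phi y); split; last exact: nbhs_singleton.
by apply: U'U; rewrite -gi; apply/(xy i); rewrite /preimage/= gi.
Qed.
(** * The mass carried by the point X *)

Lemma measurable_eq_separated (dZ d : measure_display)
    (Z : measurableType dZ) (T : measurableType d) (D : nat -> set T)
    (a b : Z -> T) :
  (forall i, measurable (D i)) ->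
  (forall x y, (forall i, D i x <-> D i y) -> x = y) ->
  measurable_fun setT a -> measurable_fun setT b ->
  measurable [set z | a z <> b z].
Proof.
move=> mD sD ma mb.
have -> : [set z | a z <> b z] =
    ~` \bigcap_i ((a @^-1` D i `&` b @^-1` D i) `|`
                  (~` (a @^-1` D i) `&` ~` (b @^-1` D i))).
  apply/seteqP; split => z /= h.
    move=> e; apply: h; apply: sD => i; case: (e i I) => -[/= ? ?]; tauto.
  move=> e; apply: h => i _; rewrite /preimage/= e.
  by have := EM (D i (b z)); tauto.
apply: measurableC; apply: bigcapT_measurable => i.
have mA := preimage_measurable ma (mD i).
have mB := preimage_measurable mb (mD i).
by apply: measurableU; apply: measurableI => //; exact: measurableC.
Qed.

Section main.
Local Open Scope ereal_scope.
Context (R : realType) (d : measure_display) (W : measurableType d).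
Variable P : probability W R.
Hypothesis P_complete : measure_is_complete P.
Context (dE dG : int -> measure_display).
Variables (E : forall n, measurableType (dE n)).
Variables (G : forall n, measurableType (dG n)).
Hypothesis E_lusin : forall n, standard_borel R (E n).
Variables (X : forall n, W -> E n) (V : forall n, W -> G n).
Variable f : forall n, (E n * G (n + 1)%R)%type -> E (n + 1)%R.
Hypothesis XVf : constructive_chain P X V f.
Local Notation XV := (pair_process X V).
Local Notation Finf := (remote_past P XV).
Local Notation Fall := (join_sigma (sigma_of V setT) Finf).
Local Notation WF := (g_sigma_algebraType Fall).
Variable mu : R.-pker WF ~> product_space E.
Let Z (w : W) : product_space E := fun n : int => X n w.
Hypothesis mu_law : is_conditional_law P Z mu.

Let Fall_algebra : sigma_algebra setT Fall := all_algebra P X V.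
Let Fall_measurable : Fall `<=` measurable := all_measurable P_complete XVf.

Lemma coord_measurable n :
  measurable_fun [set: product_space E] (fun y : product_space E => y n).
Proof.
move=> _ C mC; rewrite setTI; apply: sub_sigma_algebra.
exact: (sigma_of_gen (Y := Defs.coord (T := E)) (D := setT) I mC).
Qed.

Lemma process_measurable : measurable_fun setT Z.
Proof.
have sK : sigma_algebra setT
    [set B : set (product_space E) | measurable (Z @^-1` B)].
  split; first by rewrite /= preimage_set0.
    by move=> B mB /=; rewrite setTD; exact: measurableC mB.
  by move=> B mB /=; rewrite preimage_bigcup; exact: bigcupT_measurable.
move=> _ B mB; rewrite setTI; move: B mB.
apply: (gen_sub_sigma_algebra sK); apply: sigma_of_sub => //.
move=> k C _ mC /=.
exact: preimage_measurable (chain_measurable_X XVf (n:=k)) mC.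
Qed.

(** For K a set of times, a sequence of events, on the coordinates at times in
    K, that separates two trajectories exactly when they differ at some time of
    K. *)
Lemma separating_sequence (K : pred int) :
  exists C : nat -> set (product_space E), [/\ forall i, measurable (C i),
    forall i (F : set_system W), sigma_algebra setT F ->
      (forall k (B : set (E k)), K k -> measurable B -> F (X k @^-1` B)) ->
      F (Z @^-1` C i) &
    forall y x : product_space E,
      (forall i, C i x <-> C i y) <-> (forall k, K k -> x k = y k)].
Proof.
pose D n := sval (cid (standard_borel_separated (E_lusin n))).
have mD n i : measurable (D n i).
  by rewrite /D; case: cid => ? [/= mD _]; exact: mD.
have sD n x y : (forall i, D n i x <-> D n i y) -> x = y.
  by rewrite /D; case: cid => ? [/= _]; exact.
(* the pairs (time, index of a separating set) are enumerated by pickling *)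
pose code m : option (int * nat)%type := choice.unpickle m.
pose C m : set (product_space E) := if code m is Some (k, i) then
  if K k then (fun y : product_space E => y k) @^-1` D k i else setT else setT.
exists C; split.
- move=> m; rewrite /C; case: (code m) => [[k i]|//] /=.
  by case: (K k) => //; exact: (preimage_measurable (coord_measurable (n:=k))).
- move=> m F sF FX; rewrite /C.
  have FT : F (Z @^-1` setT).
    by rewrite preimage_setT; exact: sigma_algebra_setT.
  case: (code m) => [[k i]|//] /=.
  by case Kk: (K k) => //; exact: FX.
move=> y x; split => [h k Kk|h m]; last first.
  rewrite /C; case: (code m) => [[k i]|//] /=.
  by case Kk: (K k) => //; rewrite /preimage/= (h k Kk).
apply: sD => i; have := h (choice.pickle (k, i)).
by rewrite /C /code choice.pickleK Kk.
Qed.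

Lemma measurable_point (x : product_space E) : measurable [set x].
Proof.
have [C [mC _ sC]] := separating_sequence predT.
have -> : [set x] = \bigcap_i [set y | C i y <-> C i x].
  apply/seteqP; split => [y -> i _ //|y h].
  apply: functional_extensionality_dep => k.
  by apply: ((sC x y).1 _ k isT) => i; exact: h.
by apply: bigcapT_measurable => i; exact: measurable_setP.
Qed.

(** The mass that the conditional law of X at w gives to X(w). *)
Let U (w : W) : \bar R := mu w [set Z w].

Let mufin w : mu w setT < +oo.
Proof. by rewrite prob_kernel ltry. Qed.

(** The pairs (w, y) such that y violates, from time k to time k + 1, the
    recursion driven by V(w). *)
Let violation k : set (WF * product_space E) :=
  [set z | z.2 (k + 1)%R <> f (z.2 k, V (k + 1)%R z.1)].

Let violation_measurable k : measurable (violation k).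
Proof.
have mV : measurable_fun [set: WF] (V (k + 1)%R).
  move=> _ C mC; rewrite setTI measurable_subE//; apply: sub_sigma_algebra.
  by left; exact: sigma_of_gen.
have [S [mS sS]] := standard_borel_separated (E_lusin (k + 1)%R).
have m2 n : measurable_fun [set: WF * product_space E]
    (fun z : WF * product_space E => z.2 n).
  exact: (measurableT_comp (coord_measurable (n:=n))).
apply: (measurable_eq_separated mS sS) => //.
have mf : measurable_fun setT (@f k) by exact: (chain_measurable_f XVf).
apply: (measurableT_comp mf) => //.
apply: measurable_fun_pair => //.
exact: (measurableT_comp mV).
Qed.

(** Almost surely the trajectories drawn from mu w follow the recursion driven
    by V(w). *)
Lemma kernel_recursion k :
  {ae P, forall w : W, mu w (xsection (violation k) w) = 0}.
Proof.
apply: (disintegration_null Fall_algebra Fall_measurable process_measurable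
  mu_law) => //.
have : {ae P, forall w : W, X (k + 1)%R w = f (X k w, V (k + 1)%R w)}.
  exact: (chain_recursion XVf).
by apply: filterS => w e; apply.
Qed.

(** The innovations determine a trajectory from its values up to time n, so the
    conditional law of X gives the same mass to X(w) as to the set of
    trajectories that agree with X(w) up to time n. *)
Lemma point_mass_past n : {ae P, forall w,
  U w = mu w [set y : product_space E | forall k, (k <= n)%R -> y k = X k w]}.
Proof.
have H1 : {ae P, forall w : W, forall i : nat,
    mu w (xsection (violation (n + i%:Z)%R) w) = 0}.
  by apply: ae_foralln => i; exact: kernel_recursion.
have H2 : {ae P, forall w : W, forall i : nat, X (n + i%:Z + 1)%R w =
    f (X (n + i%:Z)%R w, V (n + i%:Z + 1)%R w)}.
  by apply: ae_foralln => i; exact: (chain_recursion XVf).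
have [C [mC _ sC]] := separating_sequence (fun k => (k <= n)%R).
apply: filterS2 H1 H2 => w h1 h2.
have mA : measurable
    [set y : product_space E | forall k, (k <= n)%R -> y k = X k w].
  rewrite (_ : [set y | _] = \bigcap_i [set y | C i y <-> C i (Z w)]).
    by apply: bigcapT_measurable => i; exact: measurable_setP.
  apply/seteqP; split => y /= h.
    by move=> i _; apply: (sC (Z w) y).2 => k kn; exact: h.
  by move=> k kn; apply: ((sC (Z w) y).1 _ k kn) => i; exact: h.
apply: measure_eq_negligible => //; first exact: measurable_point.
  rewrite (_ : _ `\` _ = set0); first exact: negligible_set0.
  by apply/seteqP; split => y // [-> h]; exfalso; exact: h.
have nD i : (mu w).-negligible (xsection (violation (n + i%:Z)%R) w).
  exists (xsection (violation (n + i%:Z)%R) w).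
  by split; [exact: measurable_xsection|exact: h1|].
apply: negligibleS (negligible_bigcup nD) => y [yA yZ].
apply: contrapT => nDy; apply: yZ.
have {}nDy i : y (n + i%:Z + 1)%R = f (y (n + i%:Z)%R, V (n + i%:Z + 1)%R w).
  by apply: contrapT => ne; apply: nDy; exists i => //; exact/xsectionP.
(* k is a variable equal to n + i, as the types of y k and X k w depend on it *)
have step i k : k = (n + i%:Z)%R -> y k = X k w.
  elim: i k => [|i IH] k; first by move=> kn; apply: yA; rewrite kn addr0.
  rewrite -addn1 PoszD addrA => ->.
  by rewrite nDy h2 IH.
apply: functional_extensionality_dep => k.
have [kn|nk] := leP k n; first exact: yA.
apply: (step `|(k - n)%R|%N).
by rewrite gez0_abs ?subr_ge0 ?ltW// addrC subrK.
Qed.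

Lemma point_mass_past_measurable n :
  measurable_fun [set: g_sigma_algebraType (past P XV n)] U.
Proof.
have [C [mC ZC sC]] := separating_sequence (fun k => (k <= n)%R).
have sn : sigma_algebra setT (past P XV n) := past_algebra _ _ _ _.
apply: (ae_eq_sub_measurable sn _ _ (point_mass_past n)).
  exact: negligible_completion.
rewrite (_ : (fun w => _) =
    (fun w => mu w [set y | forall i, C i y <-> C i (Z w)])).
  apply: (measurable_diagonal_mass
    (m := mu : g_sigma_algebraType (past P XV n) -> _)) => //.
  - move=> i; rewrite measurable_subE//; apply: ZC => // k B kn mB.
    exact: past_X.
  - move=> B mB; rewrite measurable_subE// => FB.
    exact: (law_past_measurable P_complete XVf mu_law mB FB).
apply/funext => w; congr (mu w _); apply/seteqP; split => y /= h.
  by apply/(sC (Z w) y).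
by move=> k kn; apply: ((sC (Z w) y).1 h k kn).
Qed.

Lemma point_mass_measurable : measurable_fun [set: g_sigma_algebraType Finf] U.
Proof.
move=> _ Y mY; rewrite setTI measurable_subE; last exact: remote_past_algebra.
move=> n _; rewrite -(measurable_subE (past_algebra P X V n)) -[_ @^-1` _]setTI.
exact: point_mass_past_measurable.
Qed.

Let ae_eq_remote_measurable (g h : W -> \bar R) :
  measurable_fun [set: g_sigma_algebraType Finf] h ->
  {ae P, forall w : W, g w = h w} ->
  measurable_fun [set: g_sigma_algebraType Finf] g.
Proof.
apply: ae_eq_sub_measurable; first exact: remote_past_algebra.
exact: negligible_remote_past.
Qed.

(** The pairs (w, y) such that y does not have mass U(w) form a measurable
    set. *)
Let defect_measurable : measurable [set z : WF * product_space E |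
  mu z.1 [set z.2] <> U z.1].
Proof.
have [C [mC _ sC]] := separating_sequence predT.
have mU : measurable_fun [set: WF] U.
  move=> _ Y mY; rewrite setTI measurable_subE//; apply: sub_sigma_algebra.
  right; rewrite -(measurable_subE (remote_past_algebra P X V)).
  by rewrite -[_ @^-1` _]setTI; exact: point_mass_measurable.
have mU1 : measurable_fun [set: WF * product_space E] (U \o fst).
  exact: (measurableT_comp mU).
have mm : measurable_fun [set: WF * product_space E]
    (fun z => mu z.1 [set z.2]).
  rewrite (_ : (fun z => _) =
    (fun z => mu z.1 [set y | forall i, C i y <-> C i z.2])).
    apply: (measurable_diagonal_mass
      (m := fun z : WF * product_space E => mu z.1)) => //.
    - move=> i; exact: preimage_measurable measurable_snd (mC i).
    - move=> B mB _.
      exact: (measurableT_comp (measurable_kernel mu B mB)).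
  apply/funext => z; congr (mu z.1 _); apply/seteqP; split => y /=.
    by move=> ->.
  move=> h; apply: functional_extensionality_dep => k.
  exact: ((sC z.2 y).1 h k isT).
have := measurable_neqe measurableT mm mU1; rewrite setTI.
rewrite (_ : [set z | _ != _] = [set z | mu z.1 [set z.2] <> U z.1])//.
by apply/seteqP; split => z /= /eqP.
Qed.

(** U is measurable for the conditioning sigma-algebra, hence constant under the
    conditional law: mu w-almost every point has mass U(w). *)
Lemma kernel_constant_mass :
  {ae P, forall w : W, mu w [set x | mu w [set x] <> U w] = 0}.
Proof.
have : {ae P, forall w : W, mu w (xsection [set z : WF * product_space E |
    mu z.1 [set z.2] <> U z.1] w) = 0}.
  apply: (disintegration_null Fall_algebra Fall_measurable process_measurable
    mu_law) => //.
  by apply: aeW => w; exact.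
apply: filterS => w; congr (mu w _ = 0).
by apply/seteqP; split => y; [move=> /xsectionP|move=> h; apply/xsectionP].
Qed.

Let u (w : W) : R := fine (U w).

Let UE w : U w = (u w)%:E.
Proof.
rewrite /u fineK// ge0_fin_numE//; apply: le_lt_trans (mufin w).
by apply: le_measure; rewrite ?inE//; exact: measurable_point.
Qed.

Let u_ge0 w : (0 <= u w)%R. Proof. exact: fine_ge0. Qed.

Lemma kernel_structure : {ae P, forall w : W,
  [/\ diffuse (mu w) \/ uniform_on_finite_set (mu w),
      number_of_atoms (mu w) = ((u w)^-1)%:E &
      forall x, atoms (mu w) x -> mu w [set x] = U w]}.
Proof.
apply: filterS kernel_constant_mass => w; rewrite UE => mw0.
have m1 := measurable_point.
have mw : measurable [set x | mu w [set x] = (u w)%:E].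
  rewrite (_ : [set x | _] = ~` xsection [set z : WF * product_space E |
    mu z.1 [set z.2] <> U z.1] w).
    by apply: measurableC; exact: measurable_xsection.
  apply/seteqP; split => x; rewrite -UE /=.
    by move=> e /xsectionP; apply.
  by move=> nx; apply: contrapT => ne; apply: nx; exact/xsectionP.
have mwT : mu w setT = 1 by exact: prob_kernel.
have atomsE := atoms_constant m1 mw mw0.
have [u0|u_neq0] := eqVneq (u w) 0%R.
  have dw := diffuse_constant m1 mw mw0 u0.
  split => //; first by left.
  by rewrite /number_of_atoms dw measure0 u0 invr0.
have u_gt0 : (0 < u w)%R by rewrite lt_neqAle eq_sym u_neq0 u_ge0.
split => //; first by right; exact: (uniform_constant mwT m1 mw mw0 u_gt0).
exact: (number_of_atoms_constant mwT m1 mw mw0 u_gt0).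
Qed.

Lemma number_of_atoms_measurable :
  measurable_fun [set: g_sigma_algebraType Finf]
    (fun w => number_of_atoms (mu w)).
Proof.
(* the power -1 is the inverse on nonnegative reals, with value 0 at 0 *)
apply: (@ae_eq_remote_measurable _ (fun w => (u w `^ (-1))%:E)).
  apply/measurable_EFinP.
  apply: (measurableT_comp (measurable_powR (-1))).
  exact: (measurableT_comp (fine_measurable measurableT) point_mass_measurable).
by apply: filterS kernel_structure => w [_ -> _]; rewrite powR_inv1.
Qed.

End main.

Theorem theorem3 (R : realType) (d : measure_display) (W : measurableType d)
    (P : probability W R) (P_complete : measure_is_complete P)
    (dE dG : int -> measure_display)
    (E : forall n, measurableType (dE n)) (G : forall n, measurableType (dG n))
    (E_lusin : forall n, standard_borel R (E n))
    (X : forall n, W -> E n) (V : forall n, W -> G n)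
    (f : forall n, (E n * G (n + 1)%R)%type -> E (n + 1))
    (XVf : constructive_chain P X V f)
    (mu : R.-pker
            (g_sigma_algebraType
               (join_sigma (sigma_of V setT)
                  (remote_past P (pair_process X V))))
            ~> product_space E)
    (mu_law : is_conditional_law P
                (fun w : W => (fun n : int => X n w) : product_space E) mu) :
  [/\ {ae P, forall w, diffuse (mu w) \/ uniform_on_finite_set (mu w)},
      measurable_fun [set: g_sigma_algebraType (remote_past P (pair_process X V))]
        (fun w => number_of_atoms (mu w)) &
      exists m : W -> \bar R,
        measurable_fun [set: g_sigma_algebraType (remote_past P (pair_process X V))] m /\
        {ae P, forall w x, atoms (mu w) x -> mu w [set x] = m w}].
Proof.
have KS := kernel_structure P_complete E_lusin XVf mu_law.
split.
- by apply: filterS KS => w [].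
- exact: (number_of_atoms_measurable P_complete E_lusin XVf mu_law).
- exists (fun w => mu w [set (fun n => X n w) : product_space E]); split.
    exact: (point_mass_measurable P_complete E_lusin XVf mu_law).
  by apply: filterS KS => w [].
Qed.
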